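(* Let $V^{k},V^{k+1},\dots,V^{k+M}$ be fixed finite dimensional complex vector spaces and let $\mathbb P=\mathbb P\big(\bigoplus_{i=0}^M(V^{k+i})^*\big)$ be the weighted projective space in which $(V^{k+i})^*$ has weight $k+i$. Let $X_1,X_2\subset\mathbb P$ be two normally embedded orbifolds, each polarised by $\mathcal O_{X_j}(1):=\mathcal O_{\mathbb P}(1)|_{X_j}$. Then $(X_1,\mathcal O_{X_1}(1))$ and $(X_2,\mathcal O_{X_2}(1))$ are abstractly isomorphic as polarised orbifolds if and only if there is $g\in\prod_{i}GL(V^{k+i})$ such that $g\cdot X_1=X_2$.
   Context: For a finite dimensional graded vector space $W=\bigoplus_jW^j$ with positive weights, $\mathbb C^*$ acts on $W^j$ with weight $j$ and $\mathbb P(W)=(W\setminus\{0\})/\mathbb C^*$ is the weighted projective space, regarded as an orbifold. $\mathcal O_{\mathbb P(W)}(-1)$ is the orbifold line bundle whose fibre over $[w]$ is the union of the orbit $\mathbb C^*\cdot w$ and $0$; $\mathcal O_{\mathbb P(W)}(1)$ is its dual. Elements of the dual $(W^{j})^*$ define sections of $\mathcal O_{\mathbb P(W)}(j)$; in the claim, $V^{k+i}$ is thus a space of sections of $\mathcal O_{\mathbb P}(k+i)$ (and, for $k>M$, equals $H^0(\mathcal O_{\mathbb P}(k+i))$). Here $k\gg0$. An orbifold $X\subset\mathbb P$ is embedded in the orbifold sense: locally there are orbifold charts $U'/G$ of $X$ and $U/G$ of $\mathbb P$ with the inclusion lifting to an equivariant embedding $U'\hookrightarrow U$. The embedding is normal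 if for every $i=0,\dots,M$ the restriction map $V^{k+i}=H^0(\mathcal O_{\mathbb P}(k+i))\to H^0(\mathcal O_X(k+i))$ is an isomorphism. An isomorphism of polarised orbifolds $(X_1,L_1)\cong(X_2,L_2)$ is an isomorphism of orbifolds $f\colon X_1\to X_2$ such that $f^*L_2\cong L_1$. The group $\prod_iGL(V^{k+i})$ acts on $\bigoplus_i(V^{k+i})^*$ by the dual representation, hence on $\mathbb P$. *)

(* Defs.v *)
From HB Require Import structures.
From mathcomp Require Import all_boot all_order all_fingroup all_algebra.
From mathcomp Require Import complex.
From mathcomp Require Import boolp classical_sets functions reals topology normedtype.
From mathcomp Require Import landau derive.

Set Implicit Arguments.
Unset Strict Implicit.
Unset Printing Implicit Defensive.

Import Order.TTheory GRing.Theory Num.Theory.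
Import numFieldNormedType.Exports.

Local Open Scope classical_set_scope.
Local Open Scope ring_scope.

Section differentiable_near.
Variables (K : numFieldType) (V W : normedModType K).

Lemma differentiable_near (f g : V -> W) (x : V) :
  (\forall y \near x, f y = g y) -> differentiable f x -> differentiable g x.
Proof.
move=> fg df; have fgx : f x = g x := nbhs_singleton fg.
have dfc : continuous ('d f x) by exact: diff_continuous.
have gE : g \o shift x = cst (g x) + 'd f x +o_ 0 id.
  have /eqaddoP fE := diff_locally df.
  apply/eqaddoP => e e0; have := fE _ e0.
  have : \forall h \near (0 : V), f (h + x) = g (h + x).
    have c : (h + x) @[h --> (0 : V)] --> x.
      by rewrite -[X in _ --> X]add0r; apply: cvgD; [exact: cvg_id|exact: cvg_cst].
    exact: c fg.
  move=> fg0 fe; near=> h.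
  have -> : (g \o shift x - (cst (g x) + 'd f x)) h =
            (f \o shift x - (cst (f x) + 'd f x)) h.
    by rewrite !fctE /= fgx (near fg0 h).
  by near: h.
by apply/diff_locallyP; rewrite (diff_unique dfc gE).
Unshelve. all: by end_near. Qed.

End differentiable_near.

(* The complex numbers, sealed as a field type so that the norm topology of   *)
(* numFieldNormedType is the one found by inference.                          *)
Definition Cplx (R : realType) : numClosedFieldType := R[i].

Section holomorphic_spaces.
Variable R : realType.
Local Notation C := (Cplx R).

Definition holo (V W : normedModType C) (D : set V) (f : V -> W) :=
  forall x, D x -> differentiable f x.

(* A complex manifold (or a complex submanifold, a product, a fibre product   *)
(* ...) M is recorded by the set pts of its points, inside a carrier type,    *)
(* and by the holomorphic maps D -> M from open subsets D of the spaces C^d,  *)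
(* i.e. as a concrete sheaf on the site of open subsets of the C^d. In        *)
(* plot D p only the values of p on D matter. A map of complex manifolds is   *)
(* holomorphic iff it carries such test maps to such test maps.               *)
Record hspace := Hspace {
  amb :> Type;
  pts : set amb;
  plot : forall d, set 'rV[C]_d -> ('rV[C]_d -> amb) -> Prop;
  plot_pts : forall d (D : set 'rV[C]_d) p x, plot D p -> D x -> pts (p x);
  plot_cst : forall d (D : set 'rV[C]_d) a, pts a -> plot D (fun=> a);
  plot_comp : forall d e (D : set 'rV[C]_d) (E : set 'rV[C]_e) p h,
    open D -> open E -> holo E h -> E `<=` h @^-1` D ->
    plot D p -> plot E (p \o h);
  plot_glue : forall d (D : set 'rV[C]_d) p, open D ->
    (forall x, D x -> exists E q,
       [/\ open E, E x, plot E q & forall y, E y -> p y = q y]) ->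
    plot D p
}.

Definition hmap (X Y : hspace) (f : X -> Y) :=
  forall d (D : set 'rV[C]_d) p, open D -> plot D p -> plot D (f \o p).

Lemma hmap_pts (X Y : hspace) (f : X -> Y) a : hmap f -> pts a -> pts (f a).
Proof.
move=> hf Xa.
exact: (@plot_pts Y 0 setT _ 0 (hf _ _ _ openT (plot_cst setT Xa)) I).
Qed.

Lemma hmap_comp (X Y Z : hspace) (g : Y -> Z) (f : X -> Y) :
  hmap f -> hmap g -> hmap (g \o f).
Proof. by move=> hf hg d D p oD Dp; exact: (hg _ _ (f \o p) oD (hf _ _ _ oD Dp)). Qed.

Lemma hmap_id (X : hspace) : hmap (@id X).
Proof. by []. Qed.

Lemma plot_eq (X : hspace) d (D : set 'rV[C]_d) (p q : 'rV[C]_d -> X) :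
  open D -> (forall x, D x -> p x = q x) -> plot D q -> plot D p.
Proof. by move=> oD pq Dq; apply: plot_glue => // x Dx; exists D, q. Qed.

Lemma plot_sub (X : hspace) d (D E : set 'rV[C]_d) (p : 'rV[C]_d -> X) :
  open D -> open E -> E `<=` D -> plot D p -> plot E p.
Proof.
move=> oD oE ED Dp; apply: (plot_comp (h := id) oD oE _ ED Dp) => x _.
by apply: ex_diff; exact: is_diff_id.
Qed.

Lemma holo_near (V W : normedModType C) (D : set V) (f : V -> W) :
  (forall x, D x -> exists E g,
     [/\ open E, E x, holo E g & forall y, E y -> f y = g y]) -> holo D f.
Proof.
move=> fg x /fg[E [g [oE Ex Eg fgE]]].
apply: (differentiable_near _ (Eg _ Ex)).
by apply: filterS (open_nbhs_nbhs (conj oE Ex)) => y /fgE.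
Qed.

(* The subset A of a finite dimensional vector space T whose dual is spanned  *)
(* by the functionals c j.                                                    *)
Program Definition coord_space (T J : Type) (c : J -> T -> C) (A : set T) :=
  @Hspace T A (fun d D p => D `<=` p @^-1` A /\
                 forall j, holo D (fun x => c j (p x))) _ _ _ _.
Next Obligation. by move=> T J c A d D p x [DA _] /DA. Qed.
Next Obligation.
by move=> T J c A d D a Aa; split=> // j x _; exact: differentiable_cst.
Qed.
Next Obligation.
move=> T J c A d e D E p h oD oE hE EhD [DA hp]; split=> [x /EhD/DA//|j x Ex].
exact: (@differentiable_comp _ _ _ _ h (fun y => c j (p y)) x (hE x Ex)
         (hp j _ (EhD _ Ex))).
Qed.
Next Obligation.
move=> T J c A d D p oD H; split=> [x /H[E [q [_ Ex [EA _] pq]]]|j].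
  by rewrite /preimage /= pq //; exact: EA.
apply: holo_near => x /H[E [q [oE Ex [EA hq] pq]]].
by exists E, (fun x => c j (q x)); split=> // y /pq ->.
Qed.

Program Definition domain_space n (U : set 'rV[C]_n) :=
  @Hspace 'rV[C]_n U (fun d D p => D `<=` p @^-1` U /\ holo D p) _ _ _ _.
Next Obligation. by move=> n U d D p x [DA _] /DA. Qed.
Next Obligation. by move=> n U d D a Ua; split=> // x _; exact: differentiable_cst. Qed.
Next Obligation.
move=> n U d e D E p h oD oE hE EhD [DA hp]; split=> [x /EhD/DA//|x Ex].
exact: (differentiable_comp (hE x Ex) (hp _ (EhD _ Ex))).
Qed.
Next Obligation.
move=> n U d D p oD H; split=> [x /H[E [q [_ Ex [EA _] pq]]]|].
  by rewrite /preimage /= pq //; exact: EA.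
by apply: holo_near => x /H[E [q [oE Ex [EA hq] pq]]]; exists E, q.
Qed.

Program Definition disc_space (T : Type) :=
  @Hspace T setT (fun d D p => forall x, D x ->
    exists2 E : set 'rV[C]_d, open E /\ E x & forall y, E y -> p y = p x) _ _ _ _.
Next Obligation. by []. Qed.
Next Obligation. by move=> T d D a _ x _; exists setT; split=> //; exact: openT. Qed.
Next Obligation.
move=> T d e D E p h oD oE hE EhD Dp x Ex.
have [F [oF Fx] pF] := Dp _ (EhD _ Ex).
have : nbhs x (h @^-1` F).
  by apply: (differentiable_continuous (hE x Ex)); exact: open_nbhs_nbhs.
rewrite nbhsE => -[G [oG Gx] GF]; exists G => // y /GF /pF //.
Qed.
Next Obligation.
move=> T d D p oD H x /H[E [q [oE Ex Eq pq]]].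
have [F [oF Fx] qF] := Eq _ Ex.
exists (E `&` F); first by split=> //; exact: openI.
by move=> y [Ey Fy]; rewrite !pq // qF.
Qed.

Program Definition prod_space (X Y : hspace) :=
  @Hspace (X * Y) [set xy : X * Y | pts xy.1 /\ pts xy.2]
    (fun d D p => plot D (fst \o p) /\ plot D (snd \o p)) _ _ _ _.
Next Obligation. move=> X Y d D p x [h1 h2] Dx.
by split; [exact: (plot_pts h1 Dx)|exact: (plot_pts h2 Dx)]. Qed.
Next Obligation. by move=> X Y d D a [? ?]; split; exact: plot_cst. Qed.
Next Obligation.
move=> X Y d e D E p h oD oE hE EhD [p1 p2].
by split; [exact: (plot_comp oD oE hE EhD p1)|exact: (plot_comp oD oE hE EhD p2)].
Qed.
Next Obligation.
move=> X Y d D p oD H; split; apply: plot_glue => // x /H.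
  by move=> [E [q [oE Ex [q1 _] pq]]]; exists E, (fst \o q); split=> // y /pq /= ->.
by move=> [E [q [oE Ex [_ q2] pq]]]; exists E, (snd \o q); split=> // y /pq /= ->.
Qed.

Program Definition sub_space (X : hspace) (A : set X) :=
  @Hspace X [set x : X | pts x /\ A x]
    (fun d D p => plot D p /\ D `<=` p @^-1` A) _ _ _ _.
Next Obligation. by move=> X A d D p x [h1 DA] Dx; split; [exact: (plot_pts h1 Dx)|exact: DA]. Qed.
Next Obligation. by move=> X A d D a [? ?]; split=> //; exact: plot_cst. Qed.
Next Obligation.
move=> X A d e D E p h oD oE hE EhD [p1 p2].
by split; [exact: (plot_comp oD oE hE EhD p1)|move=> x /EhD/p2].
Qed.
Next Obligation.
move=> X A d D p oD H; split.
  by apply: plot_glue => // x /H[E [q [oE Ex [q1 _] pq]]]; exists E, q.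
move=> x /H[E [q [oE Ex [_ q1] pq]]]; rewrite /preimage /= pq //; exact: q1.
Qed.

Definition complex_line := coord_space (fun _ : unit => @id C) setT.

End holomorphic_spaces.

Section orbifolds.
Variable R : realType.
Local Notation C := (Cplx R).
Local Notation hspace := (hspace R).

Record hgroup := HGroup {
  gsp :> hspace;
  g1 : gsp;
  gmul : gsp -> gsp -> gsp;
  ginv : gsp -> gsp;
  g1_pts : pts g1;
  gmul_hol : hmap (fun xy : prod_space gsp gsp => gmul xy.1 xy.2);
  ginv_hol : hmap ginv;
  gmulA : forall x y z, pts x -> pts y -> pts z ->
    gmul x (gmul y z) = gmul (gmul x y) z;
  gmul1 : forall x, pts x -> gmul g1 x = x;
  gmulr1 : forall x, pts x -> gmul x g1 = x;
  gmulV : forall x, pts x -> gmul (ginv x) x = g1;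
  gmulrV : forall x, pts x -> gmul x (ginv x) = g1
}.

Record haction (G : hgroup) (X : hspace) := HAction {
  act : G -> X -> X;
  act_hol : hmap (fun gx : prod_space G X => act gx.1 gx.2);
  act1 : forall x, pts x -> act (g1 G) x = x;
  actM : forall g h x, pts g -> pts h -> pts x ->
    act (gmul g h) x = act g (act h x)
}.

(* Orbifolds, possibly with non-trivial generic stabilisers, are presented by *)
(* holomorphic groupoids: the orbifold is the quotient (stack) of the objects *)
(* by the arrows, and its local charts are the orbifold_chart below. In       *)
(* cmp b a, b comes after a.                                                  *)
Record groupoid := Groupoid {
  ob : hspace;
  ar : hspace;
  src : ar -> ob;
  tgt : ar -> ob;
  idn : ob -> ar;
  ainv : ar -> ar;
  cmp : ar -> ar -> ar;
  src_hol : hmap src;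
  tgt_hol : hmap tgt;
  idn_hol : hmap idn;
  ainv_hol : hmap ainv;
  cmp_hol : hmap (fun ba : sub_space [set ba : prod_space ar ar |
                             src ba.1 = tgt ba.2] => cmp ba.1 ba.2);
  src_idn : forall x, pts x -> src (idn x) = x;
  tgt_idn : forall x, pts x -> tgt (idn x) = x;
  src_ainv : forall a, pts a -> src (ainv a) = tgt a;
  tgt_ainv : forall a, pts a -> tgt (ainv a) = src a;
  src_cmp : forall b a, pts b -> pts a -> src b = tgt a -> src (cmp b a) = src a;
  tgt_cmp : forall b a, pts b -> pts a -> src b = tgt a -> tgt (cmp b a) = tgt b;
  cmp_idnl : forall a, pts a -> cmp (idn (tgt a)) a = a;
  cmp_idnr : forall a, pts a -> cmp a (idn (src a)) = a;
  cmp_ainvl : forall a, pts a -> cmp (ainv a) a = idn (src a);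
  cmp_ainvr : forall a, pts a -> cmp a (ainv a) = idn (tgt a);
  cmpA : forall c b a, pts c -> pts b -> pts a -> src c = tgt b -> src b = tgt a ->
    cmp c (cmp b a) = cmp (cmp c b) a
}.

Record functor (H G : groupoid) := Functor {
  fob : ob H -> ob G;
  far : ar H -> ar G;
  fob_hol : hmap fob;
  far_hol : hmap far;
  src_far : forall a, pts a -> src (far a) = fob (src a);
  tgt_far : forall a, pts a -> tgt (far a) = fob (tgt a);
  far_idn : forall x, pts x -> far (idn x) = idn (fob x);
  far_cmp : forall b a, pts b -> pts a -> src b = tgt a ->
    far (cmp b a) = cmp (far b) (far a)
}.

Definition orbit (G : groupoid) (x : ob G) : set (ob G) :=
  [set y | exists a : ar G, [/\ pts a, src a = x & tgt a = y]].

(* The underlying set of the orbifold. *)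
Definition coarse (G : groupoid) : set (set (ob G)) :=
  [set o | exists2 x : ob G, pts x & o = orbit x].

(* The arrows of H are the arrows of G between the images of objects of H, as *)
(* a holomorphic fibre product.                                               *)
Definition fully_faithful (H G : groupoid) (f : functor H G) :=
  (forall d (D : set 'rV[C]_d) (x y : 'rV[C]_d -> ob H) (a : 'rV[C]_d -> ar G),
     open D -> plot D x -> plot D y -> plot D a ->
     (forall u, D u -> src (a u) = fob f (x u) /\ tgt (a u) = fob f (y u)) ->
     exists2 b : 'rV[C]_d -> ar H, plot D b &
       forall u, D u -> [/\ src (b u) = x u, tgt (b u) = y u & far f (b u) = a u]) /\
  (forall b b' : ar H, pts b -> pts b' -> src b = src b' -> tgt b = tgt b' ->
     far f b = far f b' -> b = b').

(* Near u, the family p of objects of G comes, up to a family of arrows, from *)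
(* a family of objects of H.                                                  *)
Definition lifts_near (H G : groupoid) (f : functor H G)
    d (D : set 'rV[C]_d) (p : 'rV[C]_d -> ob G) (u : 'rV[C]_d) :=
  exists (E : set 'rV[C]_d) (q : 'rV[C]_d -> ob H) (a : 'rV[C]_d -> ar G),
    [/\ open E, E u, E `<=` D, plot E q & plot E a] /\
    forall v, E v -> src (a v) = fob f (q v) /\ tgt (a v) = p v.

Definition weak_equivalence (H G : groupoid) (f : functor H G) :=
  fully_faithful f /\
  forall d (D : set 'rV[C]_d) (p : 'rV[C]_d -> ob G) u,
    open D -> plot D p -> D u -> lifts_near f D p u.

(* H is identified with an open suborbifold of G. *)
Definition open_embedding (H G : groupoid) (f : functor H G) :=
  fully_faithful f /\
  forall d (D : set 'rV[C]_d) (p : 'rV[C]_d -> ob G) u,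
    open D -> plot D p -> D u ->
    (exists2 x : ob H, pts x & orbit (fob f x) (p u)) -> lifts_near f D p u.

(* An isomorphism of orbifolds is a Morita equivalence of groupoids, i.e. a   *)
(* span of weak equivalences; iso_mid presents the same orbifold as G1, G2.   *)
Record orbifold_iso (G1 G2 : groupoid) := OrbifoldIso {
  iso_mid : groupoid;
  iso_left : functor iso_mid G1;
  iso_right : functor iso_mid G2;
  iso_leftP : weak_equivalence iso_left;
  iso_rightP : weak_equivalence iso_right
}.

Program Definition act_groupoid (G : hgroup) (X : hspace) (A : haction G X) :=
  @Groupoid X (prod_space G X) snd (fun gx => act A gx.1 gx.2)
    (fun x => (g1 G, x)) (fun gx => (ginv gx.1, act A gx.1 gx.2))
    (fun ba => fun a => (gmul ba.1 a.1, a.2))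
    _ _ _ _ _ _ _ _ _ _ _ _ _ _ _ _.
Next Obligation. by move=> G X A d D p oD []. Qed.
Next Obligation. by move=> G X A d D p oD; exact: act_hol. Qed.
Next Obligation.
by move=> G X A d D p oD Dp; split=> //; apply: plot_cst; exact: g1_pts.
Qed.
Next Obligation.
move=> G X A d D p oD Dp; split; last exact: (act_hol A oD Dp).
exact: (@ginv_hol G _ _ (fst \o p) oD Dp.1).
Qed.
Next Obligation.
move=> G X A d D p oD [[[p1 p2] [p3 p4]] _]; split=> //.
exact: (@gmul_hol G _ _ (fun x => ((p x).1.1, (p x).2.1)) oD (conj p1 p3)).
Qed.
Next Obligation. by []. Qed.
Next Obligation. by move=> G X A x Xx /=; rewrite act1. Qed.
Next Obligation. by []. Qed.
Next Obligation.
move=> G X A [g x] [/= Gg Xx].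
by rewrite -actM ?gmulV ?act1//; exact: (hmap_pts (@ginv_hol G)).
Qed.
Next Obligation. by []. Qed.
Next Obligation.
by move=> G X A [g x] [h y] [/= ? ?] [/= ? ?] ->; rewrite actM.
Qed.
Next Obligation. by move=> G X A [g x] [/= ? ?]; rewrite gmul1. Qed.
Next Obligation. by move=> G X A [g x] [/= ? ?]; rewrite gmulr1. Qed.
Next Obligation. by move=> G X A [g x] [/= ? ?]; rewrite gmulV. Qed.
Next Obligation. by move=> G X A [g x] [/= ? ?]; rewrite gmulrV. Qed.
Next Obligation.
by move=> G X A [g x] [h y] [l z] [/= ? ?] [/= ? ?] [/= ? ?] _ _; rewrite gmulA.
Qed.

(* The suborbifold of G over a set X of points of the underlying space: its   *)
(* charts are the preimages of X in the charts of G.                          *)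
Program Definition restrict (G : groupoid) (X : set (set (ob G))) :=
  @Groupoid (sub_space [set x : ob G | X (orbit x)])
    (sub_space [set a : ar G | X (orbit (src a)) /\ X (orbit (tgt a))])
    (@src G) (@tgt G) (@idn G) (@ainv G) (@cmp G)
    _ _ _ _ _ _ _ _ _ _ _ _ _ _ _ _.
Next Obligation.
move=> G X d D p oD [Dp DX]; split; first exact: (src_hol oD Dp).
by move=> x /DX [].
Qed.
Next Obligation.
move=> G X d D p oD [Dp DX]; split; first exact: (tgt_hol oD Dp).
by move=> x /DX [].
Qed.
Next Obligation.
move=> G X d D p oD [Dp DX]; split; first exact: (idn_hol oD Dp).
move=> x Dx; have px := plot_pts Dp Dx.
by rewrite /preimage /= src_idn // tgt_idn //; split; exact: DX.
Qed.
Next Obligation.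
move=> G X d D p oD [Dp DX]; split; first exact: (ainv_hol oD Dp).
move=> x Dx; have px := plot_pts Dp Dx.
by rewrite /preimage /= src_ainv // tgt_ainv //; have [? ?] := DX _ Dx; split.
Qed.
Next Obligation.
move=> G X d D p oD [[[Dp1 DX1] [Dp2 DX2]] Dc]; split.
  by apply: (@cmp_hol G d D p oD); split.
move=> x Dx; have p1x := plot_pts Dp1 Dx; have p2x := plot_pts Dp2 Dx.
rewrite /preimage /= src_cmp ?tgt_cmp //; try exact: Dc.
by have [_ ?] := DX1 _ Dx; have [? _] := DX2 _ Dx; split.
Qed.
Next Obligation. by move=> G X x [? _]; exact: src_idn. Qed.
Next Obligation. by move=> G X x [? _]; exact: tgt_idn. Qed.
Next Obligation. by move=> G X x [? _]; exact: src_ainv. Qed.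
Next Obligation. by move=> G X x [? _]; exact: tgt_ainv. Qed.
Next Obligation. by move=> G X b a [? _] [? _]; exact: src_cmp. Qed.
Next Obligation. by move=> G X b a [? _] [? _]; exact: tgt_cmp. Qed.
Next Obligation. by move=> G X a [? _]; exact: cmp_idnl. Qed.
Next Obligation. by move=> G X a [? _]; exact: cmp_idnr. Qed.
Next Obligation. by move=> G X a [? _]; exact: cmp_ainvl. Qed.
Next Obligation. by move=> G X a [? _]; exact: cmp_ainvr. Qed.
Next Obligation. by move=> G X c b a [? _] [? _] [? _]; exact: cmpA. Qed.

Program Definition incl (G : groupoid) (X : set (set (ob G))) :=
  @Functor (restrict X) G id id _ _ _ _ _ _.
Next Obligation. by move=> G X d D p oD []. Qed.
Next Obligation. by move=> G X d D p oD []. Qed.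
Next Obligation. by []. Qed.
Next Obligation. by []. Qed.
Next Obligation. by []. Qed.
Next Obligation. by []. Qed.

Definition disc_group (K : finGroupType) : hgroup.
Proof.
refine (@HGroup (disc_space R K) 1%g (fun x y : K => (x * y)%g) (fun x : K => (x^-1)%g) _ _ _ _ _ _ _ _) => //.
- move=> d D p oD [p1 p2] x Dx.
  have [F1 [oF F1x] h1] := p1 x Dx; have [F2 [oF2 F2x] h2] := p2 x Dx.
  exists (F1 `&` F2); first by split=> //; exact: openI.
  by move=> y [/h1 /= -> /h2 /= ->].
- move=> d D p oD p1 x Dx; have [E oE hE] := p1 x Dx.
  by exists E => // y /hE /= ->.
- by move=> *; exact: mulgA.
- by move=> *; exact: mul1g.
- by move=> *; exact: mulg1.
- by move=> *; exact: mulVg.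
- by move=> *; exact: mulgV.
Defined.

(* An orbifold chart U/K, U open in C^n and K finite, of the orbifold G. *)
Record orbifold_chart (K : finGroupType) (G : groupoid) := OrbifoldChart {
  cdim : nat;
  cdom : set 'rV[C]_cdim;
  cdom_open : open cdom;
  cact : haction (disc_group K) (domain_space cdom);
  cmap : functor (act_groupoid cact) G;
  cmap_open : open_embedding cmap
}.

Arguments cdom {K G} o _.

Definition holo_embedding (V W : normedModType C) (U : set V) (e : V -> W) :=
  [/\ holo U e, (forall x, U x -> injective ('d e x)),
      (forall x y, U x -> U y -> e x = e y -> x = y) &
      forall A, open A -> A `<=` U ->
        exists2 B, open B & e @` A = (e @` U) `&` B].

(* X, a subset of the underlying space of G, is an embedded suborbifold: near *)
(* each of its points there are orbifold charts c' = U'/K of X and c = U/K of *)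
(* G, and a K-equivariant embedding e : U' -> U lifting the inclusion (up to  *)
(* the natural isomorphism t) whose image is the part of U lying over X.      *)
Definition embedded_suborbifold (G : groupoid) (X : set (set (ob G))) :=
  X `<=` @coarse G /\
  forall x : ob G, pts x -> X (orbit x) ->
  exists (K : finGroupType) (c' : orbifold_chart K (restrict X))
    (c : orbifold_chart K G) (e : 'rV[C]_(cdim c') -> 'rV[C]_(cdim c))
    (t : domain_space (cdom c') -> ar G),
  [/\ exists2 u, cdom c' u & orbit x (fob (cmap c') u),
      holo_embedding (cdom c') e,
      forall u, cdom c u ->
        X (orbit (fob (cmap c) u)) <-> exists2 u', cdom c' u' & e u' = u,
      forall u, cdom c' u -> cdom c (e u) /\
        forall g : K, e (act (cact c') g u) = act (cact c) g (e u) &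
      [/\ hmap t,
          forall u, cdom c' u ->
            src (t u) = fob (cmap c') u /\ tgt (t u) = fob (cmap c) (e u) &
          forall (g : K) u, cdom c' u ->
            cmp (t (act (cact c') g u)) (far (cmap c') (g, u)) =
            cmp (far (cmap c) (g, e u)) (t u)]].

(* A holomorphic line bundle on the orbifold G: a line bundle on the space of *)
(* objects, on which the arrows act. The addition of the one-dimensional      *)
(* fibres is determined by the scalar multiplication scl.                     *)
Definition line_frame (X L : hspace) (prj : L -> X) (scl : C -> L -> L)
    d (E : set 'rV[C]_d) (p : 'rV[C]_d -> X) (l : 'rV[C]_d -> L) :=
  [/\ plot E l, forall u, E u -> prj (l u) = p u,
      forall u z z', E u -> scl z (l u) = scl z' (l u) -> z = z' &
      forall e (B : set 'rV[C]_e) (h : 'rV[C]_e -> 'rV[C]_d) (q : 'rV[C]_e -> L),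
        open B -> holo B h -> B `<=` h @^-1` E -> plot B q ->
        (forall v, B v -> prj (q v) = p (h v)) ->
        exists2 z : 'rV[C]_e -> C, holo B z &
          forall v, B v -> q v = scl (z v) (l (h v))].

Record line_bundle (G : groupoid) := LineBundle {
  tot : hspace;
  prj : tot -> ob G;
  scl : C -> tot -> tot;
  mov : ar G -> tot -> tot;
  prj_hol : hmap prj;
  scl_hol : hmap (fun zv : prod_space (complex_line R) tot => scl zv.1 zv.2);
  mov_hol : hmap (fun av : sub_space [set av : prod_space (ar G) tot |
                             src av.1 = prj av.2] => mov av.1 av.2);
  prj_scl : forall z v, pts v -> prj (scl z v) = prj v;
  scl1 : forall v, pts v -> scl 1 v = v;
  sclM : forall z z' v, pts v -> scl (z * z') v = scl z (scl z' v);
  prj_mov : forall a v, pts a -> pts v -> src a = prj v -> prj (mov a v) = tgt a;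
  mov_scl : forall a z v, pts a -> pts v -> src a = prj v ->
    mov a (scl z v) = scl z (mov a v);
  mov_idn : forall v, pts v -> mov (idn (prj v)) v = v;
  mov_cmp : forall b a v, pts b -> pts a -> pts v -> src b = tgt a ->
    src a = prj v -> mov (cmp b a) v = mov b (mov a v);
  line_triv : forall d (D : set 'rV[C]_d) (p : 'rV[C]_d -> ob G) u,
    open D -> plot D p -> D u ->
    exists (E : set 'rV[C]_d) (l : 'rV[C]_d -> tot),
      [/\ open E, E u, E `<=` D & line_frame prj scl E p l]
}.

Definition line_bundle_iso (G : groupoid) (L1 L2 : line_bundle G) :=
  exists (f : tot L1 -> tot L2) (f' : tot L2 -> tot L1),
  [/\ hmap f /\ hmap f',
      (forall v, pts v -> f' (f v) = v) /\ (forall v, pts v -> f (f' v) = v),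
      forall v, pts v -> prj (f v) = prj v,
      forall z v, pts v -> f (scl z v) = scl z (f v) &
      forall a v, pts a -> pts v -> src a = prj v -> f (mov a v) = mov a (f v)].

(* The holomorphic sections of L, considered up to sec_eq, form H^0(L). *)
Definition is_section (G : groupoid) (L : line_bundle G) (s : ob G -> tot L) :=
  [/\ hmap s, forall x, pts x -> prj (s x) = x &
      forall a, pts a -> s (tgt a) = mov a (s (src a))].

Definition sec_eq (G : groupoid) (L : line_bundle G) (s s' : ob G -> tot L) :=
  forall x, pts x -> s x = s' x.

Program Definition pullback (H G : groupoid) (f : functor H G)
    (L : line_bundle G) :=
  @LineBundle H
    (sub_space [set yv : prod_space (ob H) (tot L) | fob f yv.1 = prj yv.2])
    fst (fun z yv => (yv.1, scl z yv.2))
    (fun b yv => (tgt b, mov (far f b) yv.2)) _ _ _ _ _ _ _ _ _ _ _.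
Next Obligation. by move=> H G f L d D p oD [[]]. Qed.
Next Obligation.
move=> H G f L d D p oD [p1 [[p2 p3] p4]]; split.
  split=> //.
  exact: (@scl_hol _ L d D (fun x => ((p x).1, (p x).2.2)) oD (conj p1 p3)).
move=> x Dx; rewrite /preimage /= prj_scl; last exact: (plot_pts p3 Dx).
exact: p4.
Qed.
Next Obligation.
move=> H G f L d D p oD [[p1 [[p2 p3] p4]] p5].
have D2 : D `<=` fun x => src (far f (p x).1) = prj (p x).2.2.
  move=> x Dx; rewrite src_far; last exact: (plot_pts p1 Dx).
  by have /= -> := p5 _ Dx; exact: p4.
split.
  split; first exact: (tgt_hol oD p1).
  apply: (@mov_hol _ L d D (fun x => (far f (p x).1, (p x).2.2)) oD).
  by split=> //; split=> //; exact: (@far_hol _ _ f d D (fst \o p) oD p1).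
move=> x Dx; rewrite /preimage /= prj_mov.
- by rewrite tgt_far //; exact: (plot_pts p1 Dx).
- exact: (hmap_pts (@far_hol _ _ f) (plot_pts p1 Dx)).
- exact: (plot_pts p3 Dx).
- exact: D2.
Qed.
Next Obligation. by []. Qed.
Next Obligation. by move=> H G f L [y v] [[/= ? ?] _]; rewrite scl1. Qed.
Next Obligation. by move=> H G f L z z' [y v] [[/= ? ?] _]; rewrite sclM. Qed.
Next Obligation. by []. Qed.
Next Obligation.
move=> H G f L a z [y v] pa [[/= ? ?] e1] e2; rewrite mov_scl//.
  exact: (hmap_pts (@far_hol _ _ f)).
by rewrite src_far // e2.
Qed.
Next Obligation.
move=> H G f L [y v] [[/= ? ?] /= e].
by rewrite tgt_idn // far_idn // e mov_idn.
Qed.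
Next Obligation.
move=> H G f L b a [y v] pb pa [[/= ? ?] /= e] e1 e2.
rewrite tgt_cmp // far_cmp // mov_cmp //; try exact: (hmap_pts (@far_hol _ _ f)).
  by rewrite src_far // tgt_far // e1.
by rewrite src_far // e2.
Qed.
Next Obligation.
move=> H G f L d D p u oD Dp Du.
have [E [l [oE Eu ED [El lp li lq]]]] :=
  line_triv L oD (fob_hol f oD Dp) Du.
exists E, (fun x => (p x, l x)); split=> //; split=> //.
- split; last by move=> x Ex; rewrite /preimage /= lp.
  by split=> //; exact: (plot_sub oD oE ED Dp).
- by move=> x z z' Ex [] /li; exact.
- move=> e B h q oB hB BE [[q1 q2] q3] qp.
  have [|z hz zq] := lq _ B h (snd \o q) oB hB BE q2.
    by move=> v Bv /=; rewrite -(q3 _ Bv) (qp _ Bv).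
  exists z => // v Bv /=; rewrite -(qp _ Bv) -(zq _ Bv) /=.
  by case: (q v).
Qed.

Definition pullback_section (H G : groupoid) (f : functor H G)
    (L : line_bundle G) (s : ob G -> tot L) : ob H -> tot (pullback f L) :=
  fun y => (y, s (fob f y)).

Lemma pullback_sectionP (H G : groupoid) (f : functor H G)
    (L : line_bundle G) (s : ob G -> tot L) :
  is_section s -> is_section (pullback_section f s).
Proof.
move=> [sh sp se]; split=> //.
  move=> d D p oD Dp; split; first split=> //.
    exact: (hmap_comp (@fob_hol _ _ f) sh oD Dp).
  move=> x Dx; rewrite /preimage /= sp //.
  exact: (hmap_pts (@fob_hol _ _ f) (plot_pts Dp Dx)).
move=> a pa; rewrite /pullback_section /= -src_far // -tgt_far // se //.
exact: (hmap_pts (@far_hol _ _ f)).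
Qed.

(* (G1, L1) and (G2, L2) are isomorphic: there is an isomorphism f : G1 -> G2 *)
(* of orbifolds with f^*L2 isomorphic to L1, where f^*L2 is the bundle whose  *)
(* pullback to the groupoid iso_mid f (equivalent to G1) is that of L2.       *)
Definition polarised_iso (G1 : groupoid) (L1 : line_bundle G1)
    (G2 : groupoid) (L2 : line_bundle G2) :=
  exists f : orbifold_iso G1 G2,
    line_bundle_iso (pullback (iso_right f) L2) (pullback (iso_left f) L1).

(* The line bundle associated with a multiplicative character of the arrows.  *)
Program Definition char_bundle (G : groupoid) (chi : ar G -> C)
    (chi_hol : hmap (chi : ar G -> complex_line R))
    (chi_idn : forall x, pts x -> chi (idn x) = 1)
    (chi_cmp : forall b a, pts b -> pts a -> src b = tgt a ->
       chi (cmp b a) = chi b * chi a) :=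
  @LineBundle G (prod_space (ob G) (complex_line R))
    fst (fun z xv => (xv.1, z * xv.2)) (fun a xv => (tgt a, chi a * xv.2))
    _ _ _ _ _ _ _ _ _ _ _.
Next Obligation. by move=> G chi _ _ _ d D p oD []. Qed.
Next Obligation.
move=> G chi _ _ _ d D p oD [[_ p1] [p2 [_ p3]]]; split=> //; split=> // -[] x Dx.
exact: (differentiableM (p1 tt x Dx) (p3 tt x Dx)).
Qed.
Next Obligation.
move=> G chi ch _ _ d D p oD [[p1 [p2 [_ p3]]] _]; split.
  exact: (tgt_hol oD p1).
split=> // -[] x Dx; have [_ p4] := ch _ _ _ oD p1.
exact: (differentiableM (p4 tt x Dx) (p3 tt x Dx)).
Qed.
Next Obligation. by []. Qed.
Next Obligation. by move=> G chi _ _ _ [x v] _; rewrite mul1r. Qed.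
Next Obligation. by move=> G chi _ _ _ z z' [x v] _; rewrite mulrA. Qed.
Next Obligation. by []. Qed.
Next Obligation. by move=> G chi _ _ _ a z [x v] _ _ _ /=; rewrite mulrCA. Qed.
Next Obligation.
by move=> G chi _ ci _ [x v] [/= ? _]; rewrite ci // mul1r tgt_idn.
Qed.
Next Obligation.
move=> G chi _ _ cc b a [x v] pb pa _ e _ /=.
by rewrite cc // tgt_cmp // mulrA.
Qed.
Next Obligation.
move=> G chi _ _ _ d D p u oD Dp Du.
exists D, (fun x => (p x, 1)); split=> //; split=> //.
- by split=> //; exact: plot_cst.
- by move=> x z z' _ /= []; rewrite !mulr1.
- move=> e B h q oB hB BE [q1 [_ q2]] qp.
  exists (fun v => (q v).2); first exact: (q2 tt).
  by move=> v Bv /=; rewrite mulr1 -qp //; case: (q v).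
Qed.

End orbifolds.

Section weighted_projective_space.
Variable R : realType.
Local Notation C := (Cplx R).

Program Definition Cstar : hgroup R :=
  @HGroup R (coord_space (fun _ : unit => @id C) [set z | z != 0])
    1 *%R (@GRing.inv C) _ _ _ _ _ _ _ _.
Next Obligation. exact: oner_neq0. Qed.
Next Obligation.
move=> d D p oD [[A1 p1] [A2 p2]]; split=> [x Dx|j x Dx].
  by rewrite /preimage /= mulf_neq0 //; [exact: A1|exact: A2].
exact: (differentiableM (p1 tt x Dx) (p2 tt x Dx)).
Qed.
Next Obligation.
move=> d D p oD [A1 p1]; split=> [x Dx|j x Dx].
  by rewrite /preimage /= invr_eq0; exact: A1.
exact: (differentiableV (p1 tt x Dx) (A1 x Dx)).
Qed.
Next Obligation. by move=> *; rewrite mulrA. Qed.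
Next Obligation. by move=> *; rewrite mul1r. Qed.
Next Obligation. by move=> *; rewrite mulr1. Qed.
Next Obligation. by move=> x x0; rewrite mulVf. Qed.
Next Obligation. by move=> x x0; rewrite divff. Qed.

Lemma differentiable_exprz d (f : 'rV[C]_d -> C) (n : int) x :
  differentiable f x -> f x != 0 -> differentiable (fun y => f y ^ n) x.
Proof.
have dX m (g : 'rV[C]_d -> C) : differentiable g x ->
    differentiable (fun y => g y ^+ m) x.
  move=> dg; elim: m => [|m IH].
    rewrite (_ : (fun _ => _) = cst 1); first exact: differentiable_cst.
    by apply/funext => y; rewrite expr0.
  rewrite (_ : (fun _ => _) = g * (fun y => g y ^+ m)); first exact: differentiableM.
  by apply/funext => y; rewrite exprS.
move=> df fx0; case: n => m; first exact: dX.
by apply: (differentiableV (dX m.+1 _ df)); rewrite expf_neq0.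
Qed.

Variables (k M : nat) (V : 'I_M.+1 -> vectType C).

(* W is the direct sum of the duals of the V i. *)
Definition wdual := forall i : 'I_M.+1, 'Hom(V i, C^o).

Definition wcoord (j : {i : 'I_M.+1 & V i}) (w : wdual) : C :=
  w (projT1 j) (projT2 j).

Definition punctured : hspace R :=
  coord_space wcoord [set w | exists i, w i != 0].

Program Definition weight_action : haction Cstar punctured :=
  @HAction R Cstar punctured (fun z (w : wdual) i => z ^+ (k + i) *: w i) _ _ _.
Next Obligation.
move=> d D p oD [[A1 p1] [A2 p2]]; split=> [x Dx|j x Dx].
  have [i wi] := A2 x Dx; exists i.
  by rewrite scaler_eq0 negb_or wi andbT expf_neq0 //; exact: A1.
rewrite (_ : (fun _ => _) =
  (fun y => (p y).1 ^ (k + projT1 j)%:Z) * (fun y => wcoord j (p y).2)).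
  apply: differentiableM; last exact: (p2 j x Dx).
  exact: (differentiable_exprz _ (p1 tt x Dx) (A1 x Dx)).
by apply/funext => y; rewrite /wcoord /= scale_lfunE.
Qed.
Next Obligation.
move=> w _; apply: functional_extensionality_dep => i.
by rewrite expr1n scale1r.
Qed.
Next Obligation.
move=> g h w _ _ _; apply: functional_extensionality_dep => i.
by rewrite exprMn scalerA.
Qed.

(* The weighted projective orbifold of W, (V i)^* having weight k + i. *)
Definition wproj : groupoid R := act_groupoid weight_action.

(* For n = -1 the map (w, z) |-> z w identifies the fibre of the total space  *)
(* of OP (-1) over [w] with the orbit of w together with 0; see tautological.   *)
Program Definition OP (n : int) : line_bundle wproj :=
  @char_bundle R wproj (fun zw => zw.1 ^ n) _ _ _.
Next Obligation.
move=> n d D p oD [[A1 p1] _]; split=> // -[] x Dx.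
exact: (differentiable_exprz _ (p1 tt x Dx) (A1 x Dx)).
Qed.
Next Obligation. by move=> n x _; rewrite /= exp1rz. Qed.
Next Obligation. by move=> n b a _ _ _ /=; rewrite expfzMl. Qed.

Lemma tautological (a : ar wproj) (z : C) (i : 'I_M.+1) : pts a ->
  let v := @mov R wproj (OP (-1)) a (src a, z) in
  v.2 ^+ (k + i) *: v.1 i = z ^+ (k + i) *: (src a) i.
Proof.
case: a => l w [/= l0 _]; rewrite scalerA -exprMn; congr (_ ^+ _ *: _).
by rewrite exprN1 mulrAC mulVf ?mul1r.
Qed.

(* The section of OP (k + i) defined by v, a linear form on (V i)^*. *)
Definition linear_section (i : 'I_M.+1) (v : V i) :
    ob wproj -> tot (OP (k + i)%:Z) :=
  fun w => (w, (w : wdual) i v).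

Lemma linear_sectionP (i : 'I_M.+1) (v : V i) : is_section (linear_section v).
Proof.
split=> //; last by move=> -[l w] _; rewrite /linear_section /= scale_lfunE.
move=> d D p oD Dp; split=> //; split=> // -[] x Dx.
exact: (Dp.2 (existT _ i v) x Dx).
Qed.

Section suborbifolds.
Variable X : set (set (ob wproj)).

Definition OX (n : int) : line_bundle (restrict X) := pullback (incl X) (OP n).

Definition restricted_section (i : 'I_M.+1) (v : V i) :
    ob (restrict X) -> tot (OX (k + i)%:Z) :=
  pullback_section (incl X) (linear_section v).

(* For every i the restriction V i -> H^0(OX (k + i)) is an isomorphism. *)
Definition normally_embedded :=
  embedded_suborbifold X /\
  forall i : 'I_M.+1,
    (forall v v' : V i,
       sec_eq (restricted_section v) (restricted_section v') -> v = v') /\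
    (forall s : ob (restrict X) -> tot (OX (k + i)%:Z), is_section s ->
       exists v : V i, sec_eq s (restricted_section v)).

End suborbifolds.

Definition in_prod_GL (g : forall i : 'I_M.+1, 'End(V i)) :=
  forall i, lker (g i) == 0%VS.

Definition dual_act (g : forall i : 'I_M.+1, 'End(V i)) (w : wdual) : wdual :=
  fun i => (w i \o (g i)^-1)%VF.

(* The translate g X of a set X of points of wproj, i.e. of orbits. *)
Definition translate (g : forall i : 'I_M.+1, 'End(V i))
    (X : set (set (ob wproj))) : set (set (ob wproj)) :=
  [set dual_act g @` o | o in X].

End weighted_projective_space.

(* Main.v *)
(* An isomorphism of polarised orbifolds is a span l, r of weak equivalences  *)
(* from a groupoid H, with an isomorphism r^*O(1) -> l^*O(1). Both bundles are *)
(* trivial over the objects of H, so the latter is a nowhere zero function c   *)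
(* on H, equivariant for the quotient of the two characters. For v in V i the  *)
(* function c^(k+i) (r h)_i(v) on H is then equivariant for the character of   *)
(* l^*O(k+i) and descends along l to a section of O_X1(k+i), which by          *)
(* normality is the restriction of a unique A_i v in V i. The A_i are linear,  *)
(* and injective as V i injects into the sections on X2; the identity          *)
(* (l h) o A = c(h) . (r h) says that g = A^-1 maps X1 to X2.                  *)
From HB Require Import structures.
From mathcomp Require Import all_boot all_order all_algebra.
From mathcomp Require Import boolp classical_sets functions reals topology.
From mathcomp Require Import normedtype derive.
Require Import Defs.

Set Implicit Arguments.
Unset Strict Implicit.
Unset Printing Implicit Defensive.

Import Order.TTheory GRing.Theory Num.Theory.
Import numFieldNormedType.Exports.

Local Open Scope classical_set_scope.
Local Open Scope ring_scope.

(** Normality identifies each [V i] with the sections of O(k+i) on X, and a point of X is then, up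
    to the weighted action, evaluation of these sections at it; so the polarised orbifold determines
    the embedding up to these identifications. Pulling sections back along a polarised isomorphism
    changes them by invertible maps [A i]; [OX_iso_scalar], [equivariant_function_linear] and
    [mem_orbit_fob] carry this out on the middle groupoid of the span. Conversely, linear
    translations commute with the weighted [Cstar] action, hence are strict isomorphisms of
    groupoids preserving O(1): [translate_polarised_iso]. *)

(** * Descent of equivariant functions along weak equivalences *)

Section groupoids.
Variable R : realType.
Local Notation C := (Cplx R).
Local Notation groupoid := (groupoid R).

Lemma pts_cmp (G : groupoid) (b a : ar G) :
  pts b -> pts a -> src b = tgt a -> pts (cmp b a).
Proof.
move=> pb pa e.
exact: (hmap_pts (@cmp_hol _ G) (conj (conj pb pa) e :
  @pts _ (sub_space [set ba : prod_space (ar G) (ar G) | src ba.1 = tgt ba.2]) (b, a))).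
Qed.

Lemma pts_ainv (G : groupoid) (a : ar G) : pts a -> pts (ainv a).
Proof. exact: (hmap_pts (@ainv_hol _ G)). Qed.

Lemma pts_src (G : groupoid) (a : ar G) : pts a -> pts (src a).
Proof. exact: (hmap_pts (@src_hol _ G)). Qed.

Lemma pts_tgt (G : groupoid) (a : ar G) : pts a -> pts (tgt a).
Proof. exact: (hmap_pts (@tgt_hol _ G)). Qed.

Lemma orbit_eq (G : groupoid) (a : ar G) : pts a -> orbit (tgt a) = orbit (src a).
Proof.
move=> pa; apply/seteqP; split=> y [b [pb sb <-]].
  by exists (cmp b a); rewrite src_cmp // tgt_cmp //; split=> //; exact: pts_cmp.
have e : src b = tgt (ainv a) by rewrite tgt_ainv.
exists (cmp b (ainv a)); rewrite src_cmp ?tgt_cmp ?src_ainv //; last exact: pts_ainv.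
- by split=> //; apply: pts_cmp => //; exact: pts_ainv.
- exact: pts_ainv.
Qed.

Section weak_equivalences.
Variables (H G : groupoid) (f : functor H G).
Hypothesis fW : weak_equivalence f.

(** A point is a constant family over the one-point space C^0, so the condition on holomorphic
    families specialises to it. *)
Lemma weak_equivalence_ess_surj (x : ob G) : pts x ->
  exists h a, [/\ pts h, pts a, src a = fob f h & tgt a = x].
Proof.
move=> px; have [_ fS] := fW.
have [E [q [a [[oE E0 _ Eq Ea] qa]]]] :=
  fS 0%N setT (fun=> x) 0 openT (plot_cst _ px) I.
have [s t] := qa _ E0.
by exists (q 0), (a 0); split=> //; [exact: (plot_pts Eq)|exact: (plot_pts Ea)].
Qed.

Lemma weak_equivalence_full (h h' : ob H) (a : ar G) :
  pts h -> pts h' -> pts a -> src a = fob f h -> tgt a = fob f h' ->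
  exists b, [/\ pts b, src b = h, tgt b = h' & far f b = a].
Proof.
move=> ph ph' pa sa ta; have [[fF _] _] := fW.
have [b pb /(_ 0 I) [sb tb fb]] := fF 0%N setT (fun=> h) (fun=> h') (fun=> a) openT
  (plot_cst _ ph) (plot_cst _ ph') (plot_cst _ pa) (fun _ _ => conj sa ta).
by exists (b 0); split=> //; exact: (plot_pts pb).
Qed.

(** Equivariance forces the value [chi a * s h] at the target of any arrow [a] from [fob f h].
    Fullness makes it independent of the choices, and local lifts of families make it
    holomorphic. *)
Lemma equivariant_descent (chi : ar G -> complex_line R) (s : ob H -> complex_line R) :
  hmap chi -> (forall x, pts x -> chi (idn x) = 1 :> C) ->
  (forall b a, pts b -> pts a -> src b = tgt a ->
     chi (cmp b a) = (chi b : C) * chi a) ->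
  hmap s -> (forall b, pts b -> s (tgt b) = (chi (far f b) : C) * s (src b)) ->
  exists t : ob G -> complex_line R,
    [/\ hmap t, forall a, pts a -> t (tgt a) = (chi a : C) * t (src a) &
        forall h, pts h -> t (fob f h) = s h].
Proof.
move=> chi_hol chi1 chiM s_hol sE.
pose P x ha := [/\ pts ha.1, pts ha.2, src ha.2 = fob f ha.1 & tgt ha.2 = x].
(* By essential surjectivity the default 0 is taken only outside [pts]. *)
pose t x := if pselect (exists ha, P x ha) is left e
            then (chi (projT1 (cid e)).2 : C) * s (projT1 (cid e)).1 else 0.
have tE h a : pts h -> pts a -> src a = fob f h -> t (tgt a) = (chi a : C) * s h.
  move=> ph pa sa; rewrite /t; case: pselect => [e|[]]; last by exists (h, a).
  case: (cid e) => -[h' a'] [/= ph' pa' sa' ta'].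
  (* The chosen arrow [a'] and the given [a] end at the same object, so [cmp (ainv a') a] joins two
     images under [f] and lifts to an arrow of [H], where [sE] applies. *)
  have pV := pts_ainv pa'.
  have e1 : src (ainv a') = tgt a by rewrite src_ainv.
  have pc := pts_cmp pV pa e1.
  have [||b [pb sb tb fb]] := weak_equivalence_full ph ph' pc.
  - by rewrite src_cmp.
  - by rewrite tgt_cmp // tgt_ainv.
  rewrite -tb sE // fb sb mulrA -chiM ?tgt_cmp ?tgt_ainv //.
  by rewrite cmpA ?tgt_ainv // cmp_ainvr // ta' cmp_idnl.
exists t; split.
- move=> d D p oD Dp; apply: plot_glue => // u Du.
  have [E [q [a [[oE Eu _ Eq Ea] qa]]]] := fW.2 d D p u oD Dp Du.
  exists E, (fun v => (chi (a v) : C) * s (q v)); split=> //.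
    have [_ ch] := chi_hol _ _ _ oE Ea; have [_ sh] := s_hol _ _ _ oE Eq.
    by split=> // -[] v Ev; exact: (differentiableM (ch tt v Ev) (sh tt v Ev)).
  move=> v Ev; have [sa ta] := qa _ Ev.
  rewrite /= -ta; apply: tE => //; [exact: (plot_pts Eq)|exact: (plot_pts Ea)].
- move=> a pa; have [h [a0 [ph pa0 sa0 ta0]]] := weak_equivalence_ess_surj (pts_src pa).
  rewrite -ta0 (tE h a0) // mulrA -chiM // -(tE h) ?src_cmp ?tgt_cmp //.
  exact: pts_cmp.
- move=> h ph; have pfh := hmap_pts (@fob_hol _ _ _ f) ph.
  rewrite -[fob f h]tgt_idn // (tE h) ?chi1 ?mul1r ?src_idn //.
  exact: (hmap_pts (@idn_hol _ G)).
Qed.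

End weak_equivalences.

End groupoids.

(** * Functors with a strict inverse *)

Section strict_isomorphisms.
Variable R : realType.

Lemma strict_iso_weak_equivalence (H G : groupoid R)
    (f : functor H G) (f' : functor G H) :
  (forall x, pts x -> fob f' (fob f x) = x) ->
  (forall x, pts x -> fob f (fob f' x) = x) ->
  (forall a, pts a -> far f' (far f a) = a) ->
  (forall a, pts a -> far f (far f' a) = a) ->
  weak_equivalence f.
Proof.
move=> obK obK' arK arK'; split; first split.
- move=> d D x y a oD Dx Dy Da axy; exists (far f' \o a).
    exact: (far_hol f' oD Da).
  move=> u Du; have [sa ta] := axy u Du; have pa := plot_pts Da Du.
  rewrite /= src_far // tgt_far // sa ta arK' // !obK //.
    exact: (plot_pts Dy).
  exact: (plot_pts Dx).
- by move=> b b' pb pb' _ _ /(congr1 (far f')); rewrite !arK.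
- move=> d D p u oD Dp Du; exists D, (fob f' \o p), (@idn _ G \o p).
  split; first by split=> //; [exact: (fob_hol f' oD Dp)|exact: (idn_hol oD Dp)].
  move=> v Dv; have pv := plot_pts Dp Dv.
  by rewrite /= src_idn // tgt_idn // obK'.
Qed.

Definition id_functor (G : groupoid R) : functor G G.
Proof. by refine (@Functor R G G id id _ _ _ _ _ _). Defined.

Lemma id_functor_weak_equivalence (G : groupoid R) : weak_equivalence (id_functor G).
Proof. exact: (@strict_iso_weak_equivalence _ _ _ (id_functor G)). Qed.

End strict_isomorphisms.

(** * Isomorphisms of O(1) and sections on normally embedded orbifolds *)

Section projective_orbifolds.
Variables (R : realType) (k M : nat) (V : 'I_M.+1 -> vectType (Cplx R)).
Local Notation C := (Cplx R).
Local Notation wproj := (wproj k V).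
Implicit Types (X : set (set (ob wproj))).

(** Both bundles have a global fibre coordinate over [H], so a fibrewise linear isomorphism is
    multiplication by a function [c], and compatibility with arrows compares the two characters. *)
Lemma OX_iso_scalar X1 X2 (H : groupoid R)
    (l : functor H (restrict X1)) (r : functor H (restrict X2)) :
  line_bundle_iso (pullback r (OX X2 1)) (pullback l (OX X1 1)) ->
  exists c : ob H -> complex_line R,
    [/\ hmap c, forall h, pts h -> c h != 0 :> C &
        forall b, pts b ->
          (c (tgt b) : C) * (far r b).1 = (far l b).1 * (c (src b) : C)].
Proof.
move=> [p [p' [[ph _] [pK _] pprj pscl pmov]]].
(* The point of fibre coordinate [z] over [h]; [fob r h] occurs twice, for the pullback along [incl]
   and for the product defining [OP]. *)
pose v z h : tot (pullback r (OX X2 1)) := (h, (fob r h, (fob r h, z))).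
have pv z h : pts h -> pts (v z h).
  move=> Hh; have rh := hmap_pts (@fob_hol _ _ _ r) Hh.
  exact: (conj (conj Hh (conj (conj rh (conj rh.1 I)) erefl)) erefl).
have pE z h : pts h -> p (v z h) =
    (h, (fob l h, (fob l h, z * (p (v 1 h)).2.2.2))).
  move=> Hh.
  have -> : v z h = scl z (v 1 h) by rewrite /v /= mulr1.
  rewrite pscl; last exact: pv.
  have := pprj _ (pv 1 h Hh); have := hmap_pts ph (pv 1 h Hh).
  case: (p (v 1 h)) => h' [w [w' u]] /= [[_ [_ /= e2]] /= e1] e3.
  by move: e2 e1; rewrite /preimage /= e3 => -> ->.
exists (fun h => (p (v 1 h)).2.2.2); split.
- move=> d D q oD Dq.
  have Dr := fob_hol r oD Dq.
  have D1 : plot D (fun=> 1 : complex_line R) by exact: plot_cst.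
  have Dv : plot D (v 1 \o q).
    split; last by [].
    split; first exact: Dq.
    split; last by [].
    split; first exact: Dr.
    split; last exact: D1.
    exact: Dr.1.
  have Dp := ph _ _ _ oD Dv.
  exact: Dp.1.2.1.2.2.
- move=> h Hh; apply/eqP => c0.
  have : p (v 1 h) = p (v 0 h) by rewrite (pE 1) // (pE 0) // c0 !mulr0.
  move/(congr1 p'); rewrite !pK; [|exact: pv..].
  by move=> [] /eqP; rewrite oner_eq0.
- move=> b pb.
  have := pmov b (v 1 (src b)) pb (pv _ _ (pts_src pb)) erefl.
  rewrite (pE _ _ (pts_src pb)).
  have -> : mov b (v 1 (src b)) = v (far r b).1 (tgt b).
    by rewrite /v /= !mulr1 expr1z -(tgt_far r pb).
  rewrite (pE _ _ (pts_tgt pb)) => /(congr1 (fun t => t.2.2.2)) /=.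
  by rewrite mul1r expr1z mulrC.
Qed.

Section normal_embeddings.
Variables (X : set (set (ob wproj))) (H : groupoid R) (l : functor H (restrict X)).
Hypotheses (XN : normally_embedded X) (lW : weak_equivalence l).

(** Such an [s] is a section of the pullback of O(k+i); it descends along [l] to X, where normality
    makes it linear. *)
Lemma equivariant_function_linear (i : 'I_M.+1) (s : ob H -> complex_line R) :
  hmap s ->
  (forall b, pts b -> s (tgt b) = (far l b).1 ^+ (k + i) * (s (src b) : C)) ->
  exists u : V i, forall h, pts h -> s h = (fob l h : wdual V) i u.
Proof.
move=> s_hol sE.
pose chi (a : ar (restrict X)) : complex_line R := a.1 ^+ (k + i) : C.
have chi_hol : hmap chi.
  move=> d D p oD [[[A p1] _] _]; split=> // -[] x Dx.
  exact: (differentiable_exprz (k + i)%:Z (p1 tt x Dx) (A x Dx)).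
have [||t [t_hol tE ts]] := equivariant_descent lW chi_hol _ _ s_hol sE.
- by move=> x _; rewrite /chi /= expr1n.
- by move=> b a _ _ _; rewrite /chi /= exprMn.
have [|u uE] := (XN.2 i).2 (fun w => (w, (w, t w))).
  split=> //; last by move=> a pa; rewrite /= tE.
  move=> d D p oD Dp.
  exact: (conj (conj Dp (conj Dp.1 (t_hol _ _ _ oD Dp))) (fun _ _ => erefl)).
exists u => h ph; rewrite -ts //.
by have [] := uE _ (hmap_pts (@fob_hol _ _ _ l) ph).
Qed.

(** Each point of X is joined by an arrow to some [fob l h], which only rescales the values of
    linear forms of one degree; injectivity of restriction then applies. *)
Lemma linear_forms_separated i (u u' : V i) :
  (forall h, pts h -> (fob l h : wdual V) i u = (fob l h : wdual V) i u') ->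
  u = u'.
Proof.
move=> uu'; apply: (XN.2 i).1 => w pw.
have [h [a [ph pa sa <-]]] := weak_equivalence_ess_surj lW pw.
rewrite /restricted_section /pullback_section /linear_section /=.
by rewrite [a.2]sa !scale_lfunE uu'.
Qed.

(** This describes X by the objects of [H], so that both ends of a span can be compared over the
    same [h]. *)
Lemma mem_orbit_fob (o : set (ob wproj)) :
  X o <-> exists2 h, pts h & o = orbit (fob l h : ob wproj).
Proof.
split=> [Xo|[h ph ->]]; last by have [] := hmap_pts (@fob_hol _ _ _ l) ph.
have [w pw ow] := XN.1.1 _ Xo; have pX : pts (w : ob (restrict X)).
  by split=> //=; rewrite -ow.
have [h [a [ph [pa _] sa ta]]] := weak_equivalence_ess_surj lW pX.
by exists h => //; rewrite ow -sa -ta; exact: (@orbit_eq _ wproj _ pa).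
Qed.

End normal_embeddings.

End projective_orbifolds.

(** * The dual action on orbits and suborbifolds *)

Section dual_action.
Variables (R : realType) (k M : nat) (V : 'I_M.+1 -> vectType (Cplx R)).
Local Notation C := (Cplx R).
Local Notation wproj := (wproj k V).
Implicit Types (X : set (set (ob wproj))) (g : forall i : 'I_M.+1, 'End(V i)).

Definition inv_family g i : 'End(V i) := ((g i)^-1)%VF.

Lemma inv_family_prod_GL g : in_prod_GL g -> in_prod_GL (inv_family g).
Proof. by move=> gG i; apply/lker0P; exact: (can_inj (lker0_lfunVK (gG i))). Qed.

Lemma inv_familyK g : in_prod_GL g -> inv_family (inv_family g) = g.
Proof.
move=> gG; apply: functional_extensionality_dep => i; apply/lfunP => v.
rewrite -{1}[v](lker0_lfunK (gG i)).
exact: (lker0_lfunK (inv_family_prod_GL gG i)).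
Qed.

Lemma dual_actE g (w : wdual V) i v : dual_act g w i v = w i (inv_family g i v).
Proof. by rewrite /dual_act comp_lfunE. Qed.

Lemma dual_actK g : in_prod_GL g -> cancel (dual_act g) (dual_act (inv_family g)).
Proof.
move=> gG w; apply: functional_extensionality_dep => i; apply/lfunP => v.
by rewrite !dual_actE inv_familyK // /inv_family lker0_lfunK.
Qed.

Lemma dual_actVK g : in_prod_GL g -> cancel (dual_act (inv_family g)) (dual_act g).
Proof.
by move=> gG; rewrite -{2}[g]inv_familyK //; exact: (dual_actK (inv_family_prod_GL gG)).
Qed.

Lemma dual_act_scale g (z : C) (w : wdual V) :
  dual_act g (fun i : 'I_M.+1 => z ^+ (k + i) *: w i) =
  (fun i : 'I_M.+1 => z ^+ (k + i) *: dual_act g w i).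
Proof.
apply: functional_extensionality_dep => i; apply/lfunP => v.
by rewrite scale_lfunE !dual_actE scale_lfunE.
Qed.

Lemma dual_act_hol g : in_prod_GL g ->
  hmap (dual_act g : punctured V -> punctured V).
Proof.
move=> gG d D p oD [A hp]; split=> [x /A [i wi]|[i v]].
  exists i; apply: contraNneq wi => gw0; apply/eqP/lfunP => v.
  have := congr1 (fun h : 'Hom(V i, C^o) => h (g i v)) gw0.
  by rewrite /= dual_actE /inv_family lker0_lfunK // !lfunE.
rewrite (_ : (fun _ => _) =
  fun x => wcoord (existT (fun i => V i) i (inv_family g i v)) (p x)).
  exact: hp.
by apply/funext => x; exact: dual_actE.
Qed.

Lemma dual_act_orbit g (w : ob wproj) : in_prod_GL g -> pts w ->
  dual_act g @` orbit w = orbit (dual_act g w : ob wproj).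
Proof.
move=> gG pw; apply/seteqP; split=> [_ [_ [[z w'] [/= [z0 pw'] -> <-]] <-]|].
  exists (z, dual_act g w : wdual V); rewrite /= dual_act_scale; split=> //; split=> //.
  exact: (hmap_pts (dual_act_hol gG) pw).
move=> _ [[z w'] [[/= z0 _] -> <-]].
exists (fun i : 'I_M.+1 => z ^+ (k + i) *: w i); last by rewrite dual_act_scale.
by exists (z, w).
Qed.

Lemma translateK g X : in_prod_GL g -> translate (inv_family g) (translate g X) = X.
Proof.
move=> gG; have gK (o : set (wdual V)) :
    dual_act (inv_family g) @` (dual_act g @` o) = o.
  rewrite image_comp (_ : _ \o _ = id) ?image_id //.
  by apply/funext => w; exact: dual_actK.
by rewrite /translate image_comp (_ : _ \o _ = id) ?image_id //; exact/funext.
Qed.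

Lemma translate_orbit g X (w : ob wproj) : in_prod_GL g -> pts w ->
  X (orbit w) -> translate g X (orbit (dual_act g w : ob wproj)).
Proof. by move=> gG pw Xw; rewrite -dual_act_orbit //; exists (orbit w). Qed.

(** * A translation yields a polarised isomorphism *)

(** Arrows keep their scalar, so the character defining O(1) is preserved exactly. *)
Definition translation_functor g X1 X2 (gG : in_prod_GL g) (gX : translate g X1 = X2) :
  functor (restrict X1) (restrict X2).
Proof.
refine (@Functor R (restrict X1) (restrict X2) (dual_act g)
  (fun a => (a.1, dual_act g a.2)) _ _ _ _ _ _) => //; rewrite -?gX.
- move=> d D p oD [Dp DX]; split; first exact: (dual_act_hol gG oD Dp).
  by move=> x Dx; apply: (translate_orbit gG); [exact: (plot_pts Dp Dx)|exact: DX].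
- move=> d D p oD [[p1 p2] DX]; split.
    split; [exact: p1|exact: (dual_act_hol gG oD p2)].
  move=> x Dx; have [Xs Xt] := DX x Dx; split.
    by apply: (translate_orbit gG) => //; exact: (plot_pts p2 Dx).
  rewrite /= -dual_act_scale; apply: (translate_orbit gG) => //.
  exact: (pts_tgt (G := wproj) (conj (plot_pts p1 Dx) (plot_pts p2 Dx))).
- by move=> a _; rewrite /= dual_act_scale.
Defined.

Lemma translation_functor_weak_equivalence g X1 X2 (gG : in_prod_GL g)
    (gX : translate g X1 = X2) : weak_equivalence (translation_functor gG gX).
Proof.
have gVX : translate (inv_family g) X2 = X1 by rewrite -gX translateK.
apply: (@strict_iso_weak_equivalence _ _ _ _
          (translation_functor (inv_family_prod_GL gG) gVX)).
- by move=> x _; exact: (dual_actK gG x).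
- by move=> x _; exact: (dual_actVK gG x).
- by move=> [z x] _; exact: (congr1 (pair z) (dual_actK gG x)).
- by move=> [z x] _; exact: (congr1 (pair z) (dual_actVK gG x)).
Qed.

Lemma translate_polarised_iso g X1 X2 :
  in_prod_GL g -> translate g X1 = X2 -> polarised_iso (OX X1 1) (OX X2 1).
Proof.
move=> gG gX; pose F := translation_functor gG gX.
exists (OrbifoldIso (id_functor_weak_equivalence (restrict X1))
          (translation_functor_weak_equivalence gG gX)).
(* Fibre coordinates are unchanged; only the base point in [wproj] is exchanged with its
   translate. *)
exists (fun t => (t.1, (t.1, (t.1, t.2.2.2)))),
  (fun t => (t.1, (fob F t.1, (fob F t.1, t.2.2.2)))); split.
- split=> d D p oD [[Dp [[_ [_ Dz]] _]] _].
    exact: (conj (conj Dp (conj (conj Dp (conj Dp.1 Dz)) (fun _ _ => erefl)))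
                 (fun _ _ => erefl)).
  have DF := fob_hol F oD Dp.
  exact: (conj (conj Dp (conj (conj DF (conj DF.1 Dz)) (fun _ _ => erefl)))
               (fun _ _ => erefl)).
- split=> -[y [w [w' z]]] [[_ [_ /= e1]] /= e2] /=.
    by move: e1 e2; rewrite /preimage /= => <- <-.
  by move: e1 e2; rewrite /preimage /= => <- <-.
- by [].
- by [].
- by move=> [z y] [y' [w [w' t]]].
Qed.

(** * A polarised isomorphism yields a translation *)

Lemma polarised_iso_translate X1 X2 :
  normally_embedded X1 -> normally_embedded X2 ->
  polarised_iso (OX X1 1) (OX X2 1) ->
  exists g, in_prod_GL g /\ translate g X1 = X2.
Proof.
move=> N1 N2 [[H l r lW rW] /= /OX_iso_scalar [c [c_hol c0 cE]]].
have pullE (i : 'I_M.+1) (v : V i) : exists u : V i, forall h, pts h ->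
    (c h : C) ^+ (k + i) * (fob r h : wdual V) i v = (fob l h : wdual V) i u.
  apply: (equivariant_function_linear N1 lW
            (s := fun h => (c h : C) ^+ (k + i) * (fob r h : wdual V) i v)).
    move=> d D p oD Dp; have [_ ch] := c_hol _ _ _ oD Dp.
    have [[_ rh] _] := fob_hol r oD Dp; split=> // -[] x Dx.
    have cx := differentiable_exprz (k + i)%:Z (ch tt x Dx) (c0 _ (plot_pts Dp Dx)).
    exact: (differentiableM cx (rh (existT (fun i => V i) i v) x Dx)).
  (* By [cE], the factor [c] trades the character along [r] for the one along [l]; the power k+i
     matches the degree. *)
  move=> b pb.
  have -> : (fob r (tgt b) : wdual V) i v =
      (far r b).1 ^+ (k + i) * (fob r (src b) : wdual V) i v.
    by rewrite -(tgt_far r pb) -(src_far r pb) /= scale_lfunE.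
  by rewrite !mulrA -!exprMn cE.
have [A AE] : exists A : forall i, 'End(V i), forall (i : 'I_M.+1) (v : V i) h, pts h ->
    (c h : C) ^+ (k + i) * (fob r h : wdual V) i v = (fob l h : wdual V) i (A i v).
  suff Ai (i : 'I_M.+1) : exists Ai : 'End(V i), forall (v : V i) h, pts h ->
      (c h : C) ^+ (k + i) * (fob r h : wdual V) i v = (fob l h : wdual V) i (Ai v).
    by exists (fun i => projT1 (cid (Ai i))) => i; exact: (projT2 (cid (Ai i))).
  have [a aE] := choice (pullE i).
  (* Uniqueness gives linearity: both sides induce the same function on [H] through [l]. *)
  have a_lin : linear a.
    move=> z v v'; apply: (linear_forms_separated N1 lW) => h ph.
    rewrite -aE // (linearP ((fob l h : wdual V) i)) (linearP ((fob r h : wdual V) i)).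
    by rewrite /= mulrDr -!aE // mulrCA.
  pose aL := GRing.isLinear.Build _ _ _ _ a a_lin.
  pose al : {linear V i -> V i} := HB.pack a aL.
  by exists (linfun al) => v h ph; rewrite lfunE; exact: aE.
have A0 : in_prod_GL A.
  move=> i; apply/lker0P => v v' Avv'.
  apply: (linear_forms_separated N2 rW) => h ph.
  apply: (mulfI (expf_neq0 (k + i) (c0 _ ph))).
  by rewrite !AE // Avv'.
have orbE h : pts h ->
    dual_act (inv_family A) @` orbit (fob l h : ob wproj) = orbit (fob r h : ob wproj).
  move=> ph; have [pl _] := hmap_pts (@fob_hol _ _ _ l) ph.
  have [pr _] := hmap_pts (@fob_hol _ _ _ r) ph.
  (* Acting by the inverse of [A] on the dual is precomposition with [A], so [AE] puts the translate
     of [fob l h] in the [Cstar]-orbit of [fob r h]. *)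
  have lE : dual_act (inv_family A) (fob l h) =
      (fun i : 'I_M.+1 => (c h : C) ^+ (k + i) *: (fob r h : wdual V) i).
    apply: functional_extensionality_dep => i; apply/lfunP => v.
    by rewrite dual_actE inv_familyK // scale_lfunE -AE.
  apply: (etrans (dual_act_orbit (inv_family_prod_GL A0) pl)); rewrite lE.
  exact: (@orbit_eq _ wproj (c h, fob r h) (conj (c0 _ ph) pr)).
exists (inv_family A); split; first exact: inv_family_prod_GL.
apply/seteqP; split=> [_ [o /(mem_orbit_fob N1 lW) [h ph ->] <-]|o].
  by rewrite orbE //; apply/(mem_orbit_fob N2 rW); exists h.
move=> /(mem_orbit_fob N2 rW) [h ph ->]; exists (orbit (fob l h : ob wproj)).
  by apply/(mem_orbit_fob N1 lW); exists h.
exact: orbE.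
Qed.

End dual_action.

Theorem proposition2p22 (R : realType) (k M : nat) (hk : (0 < k)%N)
    (V : 'I_M.+1 -> vectType (Cplx R))
    (X1 X2 : set (set (ob (wproj k V))))
    (hX1 : normally_embedded X1) (hX2 : normally_embedded X2) :
  polarised_iso (OX X1 1) (OX X2 1) <->
  exists g : forall i : 'I_M.+1, 'End(V i),
    in_prod_GL g /\ translate g X1 = X2.
Proof.
split; first exact: polarised_iso_translate.
by move=> [g [gG gX]]; exact: (translate_polarised_iso gG gX).
Qed.
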